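(* Let $(\Omega,d)$ be a compact metric space, $T:\Omega\to\Omega$ a continuous map with $h_{\mathrm{top}}(T,\Omega)<\infty$, and let $\nu$ be a Borel probability measure on $\Omega$ (not necessarily $T$-invariant) which is Ahlfors-Bowen with parameter $h=h_{\mathrm{top}}(T,\Omega)$. Let $X=\{X_n\}_{n\ge1}$ be a sequence of real-valued random variables on $\Omega$ (not assumed continuous). Assume that (A1) $\{X_n\}$ satisfies the weak Bowen condition; (A2) $\{X_n\}$ is weakly almost additive; (A3) $T$ is expansive and strongly topologically exact. Suppose that $\{\frac1nX_n\}_{n\in\mathbb{N}}$ satisfies, with respect to $\nu$, the large deviations principle with an essentially strictly convex good rate function $I_X$. Then: (i) there exist extended real numbers $-\infty\le\underline\alpha\le\overline\alpha\le+\infty$ such that $(\underline\alpha,\overline\alpha)\subset\mathcal{L}_X\subset[\underline\alpha,\overline\alpha]$; (ii) $h_{\mathrm{top}}(T,K_\alpha)=h_{\mathrm{top}}(T,\Omega)-I_X(\alpha)$ for all $\alpha\in(\underline\alpha,\overline\alpha)$.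
   Context: Random variables on $\Omega$ are Borel measurable functions. For $\alpha\in\mathbb{R}$, $K_\alpha=\{x\in\Omega:\lim_{n\to\infty}\frac1nX_n(x)=\alpha\}$ and $\mathcal{L}_X=\{\alpha\in\mathbb{R}:K_\alpha\ne\emptyset\}$. Bowen metric and balls: for $n\in\mathbb{N}=\{1,2,\dots\}$, $d_n(x,y)=\max_{0\le i\le n-1}d(T^ix,T^iy)$ and $B_n(x,\varepsilon)=\{y\in\Omega:d_n(x,y)<\varepsilon\}$. Topological entropy (Bowen) of an arbitrary subset $Z\subset\Omega$: for $t\in\mathbb{R}$, $\varepsilon>0$, $N\in\mathbb{N}$ let $$m(Z,t,\varepsilon,N)=\inf\Big\{\sum_{i=1}^\infty e^{-n_it}:Z\subset\bigcup_{i=1}^\infty B_{n_i}(x_i,\varepsilon),\ n_i\ge N\Big\}$$ (with $m(\emptyset,t,\varepsilon,N)=0$), $m(Z,t,\varepsilon)=\lim_{N\to\infty}m(Z,t,\varepsilon,N)$, $h_{\mathrm{top}}(T,Z,\varepsilon)=\inf\{t\in\mathbb{R}:m(Z,t,\varepsilon)=0\}$, and $h_{\mathrm{top}}(T,Z)=\lim_{\varepsilon\to0+}h_{\mathrm{top}}(T,Z,\varepsilon)$; by convention $h_{\mathrm{top}}(T,\emptyset)=-\infty$. A Borel probability measure $m$ on $\Omega$ is Ahlfors-Bowen with parameter $h>0$ if for every $\varepsilon>0$ there is a finite constant $C(\varepsilon)>0$ such that for every $n\ge1$ and all $\omega\in\Omega$, $\frac{1}{C(\varepsilon)}e^{-nh}\le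 m(B_n(\omega,\varepsilon))\le C(\varepsilon)e^{-nh}$. Weak Bowen condition: for $H:\Omega\to\mathbb{R}$ put $v_{n,\delta}(H)=\sup_{d_n(y,z)\le\delta}|H(y)-H(z)|$; $\{X_n\}$ satisfies the weak Bowen condition if there exists $\delta>0$ with $\lim_{n\to\infty}\frac{v_{n,\delta}(X_n)}{n}=0$. Weakly almost additive: there are constants $A_n\ge0$ with $\lim_{n\to\infty}A_n/n=0$ such that $|X_{n+m}(x)-X_n(x)-X_m(T^nx)|\le A_n$ for all $x\in\Omega$ and $n,m\in\mathbb{N}$. Expansive: there is $\rho>0$ such that if $d(T^nx,T^ny)<\rho$ for all integers $n\ge0$ then $x=y$. Strongly topologically exact: for every $\varepsilon>0$ there is $M_1\in\mathbb{N}$ such that $T^{n+M_1}(B_n(x,\varepsilon))=\Omega$ for all $n\in\mathbb{N}$, $x\in\Omega$. Rate function: a lower semicontinuous function $I:\mathbb{R}\to[0,+\infty]$; it is good if $\{t:I(t)\le\lambda\}$ is compact for all $\lambda\in\mathbb{R}$. $\{\frac1nX_n\}$ satisfies the large deviations principle (with respect to $\nu$) with rate function $I$ if for all Borel $E\subset\mathbb{R}$, $$-\inf_{E^\circ}I\le\liminf_{n\to\infty}\frac1n\log\nu\big(\{\tfrac1nX_n\in E\}\big)\le\limsup_{n\to\infty}\frac1n\log\nu\big(\{\tfrac1nX_n\in E\}\big)\le-\inf_{\overline E}I,$$ where $E^\circ,\overline E$ are the interior and closure of $E$ ($\inf\emptyset=+\infty$, $\log0=-\infty$). Essentially strictly convex: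 a convex function $\phi:\mathbb{R}\to\mathbb{R}\cup\{\pm\infty\}$ is proper if it never takes the value $-\infty$ and is not identically $+\infty$. For proper convex $\phi$ let $\mathrm{dom}(\phi)=\{t:\phi(t)<+\infty\}$, $\partial\phi(t)=\{t^*\in\mathbb{R}:\phi(t)+t^*(s-t)\le\phi(s)\ \forall s\in\mathbb{R}\}$ for $t\in\mathrm{dom}(\phi)$, and $\mathrm{dom}(\partial\phi)=\{t\in\mathrm{dom}(\phi):\partial\phi(t)\ne\emptyset\}$. A proper convex function $\phi$ is essentially strictly convex if it is strictly convex on every convex subset of $\mathrm{dom}(\partial\phi)$. *)

(* Defs.v *)
From HB Require Import structures.
From mathcomp Require Import all_boot all_order all_algebra.
From mathcomp Require Import all_classical all_reals all_analysis.

Set Implicit Arguments.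
Unset Strict Implicit.
Unset Printing Implicit Defensive.

Import Order.TTheory GRing.Theory Num.Theory.
Import numFieldNormedType.Exports.

Local Open Scope classical_set_scope.
Local Open Scope ring_scope.

(* The library's measurable types are pointed, so Borel measures are put on
   pointed metric spaces; a space carrying a probability measure is nonempty,
   and nothing below depends on the base point. *)
#[short(type="pmetricType")]
HB.structure Definition PMetric (K : numDomainType) :=
  { M of Pointed M & Metric K M }.

Definition borelType (R : realType) (Omega : pmetricType R) :=
  g_sigma_algebraType (@open Omega).

Section Dynamics.
Context {R : realType} {Omega : metricType R}.
Implicit Types (T : Omega -> Omega) (Z : set Omega) (H : Omega -> R).
Implicit Types (X : nat -> Omega -> R) (t e : R) (n N : nat).

(* For n >= 1 this is the maximum over 0 <= i <= n - 1, the distances being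
   nonnegative. *)
Definition bowen_dist T n (x y : Omega) : R :=
  \big[Num.max/0]_(i < n) mdist (iter i T x) (iter i T y).

Definition bowen_ball T n (x : Omega) e : set Omega :=
  [set y | bowen_dist T n x y < e].

Definition bowen_cover T Z e N : set (nat -> nat * Omega) :=
  [set c | (forall i, (N <= (c i).1)%N) /\
           Z `<=` \bigcup_i bowen_ball T (c i).1 (c i).2 e].

Definition bowen_outer T Z t e N : \bar R :=
  if Z == set0 then 0%E else
  ereal_inf [set (\sum_(0 <= i <oo) (expR (- ((c i).1%:R * t)))%:E)%E
            | c in bowen_cover T Z e N].

Definition bowen_outer_lim T Z t e : \bar R :=
  limn (fun N => bowen_outer T Z t e N).

Lemma is_cvg_bowen_outer T Z t e : cvgn (fun N => bowen_outer T Z t e N).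
Proof.
apply: ereal_nondecreasing_is_cvgn => M N MN; rewrite /bowen_outer.
case: ifPn => // _; apply: ereal_inf_le_tmp => _ [c [cN Zc] <-].
by exists c => //; split => // i; exact: leq_trans (cN i).
Qed.

Definition entropy_at T Z e : \bar R :=
  ereal_inf [set t%:E | t in [set t : R | bowen_outer_lim T Z t e = 0%E]].

Definition htop T Z : \bar R := lim (entropy_at T Z e @[e --> 0^'+]).

Lemma bowen_outer_ge0 T Z t e N : (0 <= bowen_outer T Z t e N)%E.
Proof.
rewrite /bowen_outer; case: ifPn => // _.
apply: le_ereal_inf_tmp => _ [c _ <-].
by apply: nneseries_ge0 => i _ _; rewrite lee_fin expR_ge0.
Qed.

Lemma entropy_at_nonincreasing T Z e e' :
  e <= e' -> (entropy_at T Z e' <= entropy_at T Z e)%E.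
Proof.
move=> ee'; apply: ereal_inf_le_tmp => _ [t /= mt <-]; exists t => //=.
apply/eqP; rewrite eq_le; apply/andP; split; last first.
  apply: lime_ge; first exact: is_cvg_bowen_outer.
  by apply: nearW => N; exact: bowen_outer_ge0.
rewrite -mt; apply: lee_lim; try exact: is_cvg_bowen_outer.
apply: nearW => N; rewrite /bowen_outer; case: ifPn => // _.
apply: ereal_inf_le_tmp => _ [c [cN Zc] <-]; exists c => //; split => //.
by move=> z /Zc [i _ zi]; exists i => //; exact: lt_le_trans ee'.
Qed.

Lemma is_cvg_entropy_at T Z : cvg (entropy_at T Z e @[e --> 0^'+]).
Proof.
apply: nonincreasing_at_right_is_cvge; apply: nearW => x e e' _ _.
exact: entropy_at_nonincreasing.
Qed.

Lemma htop0 T : htop T set0 = -oo%E.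
Proof.
rewrite /htop (_ : entropy_at T set0 = cst -oo%E); first exact: lim_cst.
apply/funext => e; rewrite /= /entropy_at -ereal_inf_real; congr ereal_inf.
apply/seteqP; split => _ [t _ <-]; exists t => //=.
by rewrite /bowen_outer_lim /bowen_outer eqxx lim_cst.
Qed.

Definition oscillation T n (delta : R) H : \bar R :=
  ereal_sup [set `|H p.1 - H p.2|%:E
            | p in [set p : Omega * Omega | bowen_dist T n p.1 p.2 <= delta]].

Definition weak_bowen T X : Prop :=
  exists2 delta : R, 0 < delta &
    ((n%:R^-1)%:E * oscillation T n delta (X n))%E @[n --> \oo] --> 0%E.

(* Sequences indexed by n >= 1 are functions on nat whose value at 0 is
   irrelevant. *)
Definition weakly_almost_additive T X : Prop :=
  exists A : nat -> R,
    [/\ forall n, (0 < n)%N -> 0 <= A n,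
        A n / n%:R @[n --> \oo] --> 0 &
        forall x n m, (0 < n)%N -> (0 < m)%N ->
          `|X (n + m)%N x - X n x - X m (iter n T x)| <= A n].

Definition expansive T : Prop :=
  exists2 rho : R, 0 < rho &
    forall x y,
      (forall n : nat, mdist (iter n T x) (iter n T y) < rho) -> x = y.

Definition strongly_topologically_exact T : Prop :=
  forall e : R, 0 < e -> exists2 M1 : nat, (0 < M1)%N &
    forall n x, (0 < n)%N -> iter (n + M1) T @` bowen_ball T n x e = setT.

Definition level_set X (alpha : R) : set Omega :=
  [set x | X n x / n%:R @[n --> \oo] --> alpha].

Definition level_spectrum X : set R :=
  [set alpha | level_set X alpha !=set0].

End Dynamics.

Definition ahlfors_bowen (R : realType) (Omega : pmetricType R)
    (T : Omega -> Omega) (nu : probability (borelType Omega) R) (h : R) : Prop :=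
  0 < h /\
  forall e : R, 0 < e -> exists2 C : R, 0 < C &
    forall (n : nat) (w : Omega), (0 < n)%N ->
      ((C^-1 * expR (- (n%:R * h)))%:E <= nu (bowen_ball T n w e) /\
       nu (bowen_ball T n w e) <= (C * expR (- (n%:R * h)))%:E)%E.

Definition rate_function (R : realType) (I : R -> \bar R) : Prop :=
  lower_semicontinuous I /\ forall t, (0 <= I t)%E.

Definition good_rate_function (R : realType) (I : R -> \bar R) : Prop :=
  rate_function I /\ forall l : R, compact [set t | (I t <= l%:E)%E].

Definition LDP (R : realType) (Omega : pmetricType R)
    (nu : probability (borelType Omega) R) (X : nat -> Omega -> R)
    (I : R -> \bar R) : Prop :=
  rate_function I /\
  forall E : set R, measurable E ->
    let u n := ((n%:R^-1)%:E * lne (nu [set x | E (X n x / n%:R)%R]))%E in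
    [/\ (- ereal_inf (I @` E°) <= limn_einf u)%E,
        (limn_einf u <= limn_esup u)%E &
        (limn_esup u <= - ereal_inf (I @` closure E))%E].

Section Convexity.
Context {R : realType}.
Implicit Type phi : R -> \bar R.

(* The right-hand side is meaningful since phi never takes the value -oo. *)
Definition proper_convex phi : Prop :=
  [/\ forall t, phi t != -oo%E,
      exists t, phi t != +oo%E &
      forall x y l : R, 0 < l < 1 ->
        (phi (l * x + (1 - l) * y)%R <= l%:E * phi x + (1 - l)%:E * phi y)%E].

Definition edom phi : set R := [set t | (phi t < +oo)%E].

Definition subdifferential phi (t : R) : set R :=
  [set u | forall s : R, (phi t + (u * (s - t))%:E <= phi s)%E].

Definition dom_subdifferential phi : set R :=
  [set t | edom phi t /\ subdifferential phi t !=set0].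

Definition essentially_strictly_convex phi : Prop :=
  proper_convex phi /\
  forall C : set R, @convex_set R R^o C -> C `<=` dom_subdifferential phi ->
    forall x y l : R, C x -> C y -> x != y -> 0 < l < 1 ->
      (phi (l * x + (1 - l) * y)%R < l%:E * phi x + (1 - l)%:E * phi y)%E.

End Convexity.

(* Main.v *)
Require Import Defs.
From mathcomp Require Import all_boot all_order all_algebra.
From mathcomp Require Import all_classical all_reals all_analysis.
From mathcomp Require Import measurable_realfun zify ring lra.

(** Why the theorem is true.  Put [h] for the entropy of the whole space; by the
Ahlfors-Bowen hypothesis every Bowen ball of length [n] has measure
[exp (- n h)] up to a constant.  A maximal [n]-separated set of points whose
average at time [n] is near [a] therefore has, up to subexponential factors,
[exp (n h)] times the measure of these points as cardinality, and the large
deviations principle evaluates this to [exp (n (h - I a))].  The rest of the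
proof turns this count into the entropy of the level set of [a].

The set of attained levels is the effective domain of [I], and [al], [ar] are
its endpoints; it contains the interval between them by convexity.  If some
orbit has averages converging to [a], then by the weak Bowen condition the
deviation event near [a] contains a Bowen ball of measure about [exp (- n h)],
so that [I a <= h] ([level_set_rate_le]).

Upper bound ([htop_level_set_le]).  The level set is covered by the sets of
points with average near [a] at the times [n_0], [n_1] and so on, for any
sequence of times tending to infinity; each of these is spanned by about
[exp (n (h - I a))] Bowen balls, whose total weight at an exponent
[t > h - I a] is as small as desired for [n] large.

Lower bound and nonemptiness ([level_set_nonempty], [htop_level_set_ge]).
Strong exactness allows orbits to shadow arbitrary successive blocks with a
constant gap [M] ([shadowing]).  Take the [j]-th block in a large separated set
[E (n0 + j)] of points with averages near [a] at time [n0 + j].  Block lengths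
tend to infinity, so the errors made per block (gap, almost additivity, Bowen
oscillation) become negligible per unit of length; they grow only linearly, so
that the block in progress is negligible with respect to the past.  Hence every
shadowing orbit lies in the level set ([level_set_blocks]).

The entropy of the set of shadowing orbits is bounded below by a greedy choice
of blocks, in the role of a measure spread evenly over them.  If the weights
[exp (- n_i t)] of a cover by Bowen balls had a small sum, blocks could be
chosen one after the other, each time one that meets at most its share of the
total weight of the cover: a ball long enough to distinguish the candidates
meets at most one of them, and a shorter ball weighs more than the total that
remains.  The orbit obtained in the limit would not be covered
([moran_bowen_outer]). *)

Set Implicit Arguments.
Unset Strict Implicit.
Unset Printing Implicit Defensive.

Import Order.TTheory GRing.Theory Num.Theory.
Import numFieldNormedType.Exports.

Local Open Scope classical_set_scope.
Local Open Scope ring_scope.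

(** * Bowen metrics and separated sets *)

Section BowenMetric.
Context {R : realType} {Omega : metricType R} (T : Omega -> Omega).
Implicit Types (x y z : Omega) (n m s : nat) (e : R).

Lemma mdist_le_bowen n i x y : (i < n)%N ->
  mdist (iter i T x) (iter i T y) <= bowen_dist T n x y.
Proof.
move=> ltin.
exact: (le_bigmax _ (fun j : 'I_n => mdist (iter j T x) (iter j T y))
  (Ordinal ltin)).
Qed.

Lemma bowen_dist_leP n x y e : 0 <= e ->
  (forall i, (i < n)%N -> mdist (iter i T x) (iter i T y) <= e) ->
  bowen_dist T n x y <= e.
Proof. by move=> e0 H; apply/bigmax_leP; split=> // i _; exact: H. Qed.

Lemma bowen_dist_ge0 n x y : 0 <= bowen_dist T n x y.
Proof. exact: bigmax_ge_id. Qed.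

Lemma bowen_dist_sym n x y : bowen_dist T n x y = bowen_dist T n y x.
Proof. by rewrite /bowen_dist; under eq_bigr do rewrite metric_sym. Qed.

Lemma bowen_dist_triangle n y x z :
  bowen_dist T n x z <= bowen_dist T n x y + bowen_dist T n y z.
Proof.
apply: bowen_dist_leP => [|i ltin]; first by rewrite addr_ge0 ?bowen_dist_ge0.
apply: le_trans (metric_triangle _ (iter i T y) _) _.
by apply: lerD; exact: mdist_le_bowen.
Qed.

Lemma bowen_dist_shift n m s x y : (s + n <= m)%N ->
  bowen_dist T n (iter s T x) (iter s T y) <= bowen_dist T m x y.
Proof.
move=> snm; apply: bowen_dist_leP => [|i ltin]; first exact: bowen_dist_ge0.
rewrite -!iterD; apply: mdist_le_bowen.
by apply: leq_trans snm; rewrite addnC ltn_add2l.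
Qed.

Lemma near_bowen_dist n x e : continuous T -> 0 < e ->
  \forall y \near x, bowen_dist T n x y < e.
Proof.
move=> Tc e0.
have iter_cont i : continuous (iter i T).
  elim: i => [|i IH] y; first exact: cvg_id.
  exact: (@continuous_comp _ _ _ (iter i T) T y (IH y) (Tc _)).
have : \forall y \near x, forall i : 'I_n,
    mdist (iter i T x) (iter i T y) < e.
  apply: filter_forall => i.
  have /= := iter_cont i x _ (nbhsx_ballx (iter i T x) e e0).
  by rewrite ballEmdist.
apply: filterS => y Hy; apply/bigmax_ltP; split=> // i _; exact: Hy.
Qed.

Lemma open_bowen_ball n x e : continuous T -> open (bowen_ball T n x e).
Proof.
move=> Tc; rewrite openE => y /=; rewrite /bowen_ball /= => xye.
have e0 : 0 < e - bowen_dist T n x y by rewrite subr_gt0.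
apply: filterS (near_bowen_dist n y Tc e0) => z /= yz.
by apply: le_lt_trans (bowen_dist_triangle _ y _ _) _; rewrite -ltrBrDl.
Qed.

(** A separated subset of [G] of the largest possible cardinality spans [G], for
otherwise it could be enlarged. *)
Lemma maximal_separated (G : set Omega) n e (b : nat) : 0 < e ->
  (forall E : seq Omega,
     pairwise (fun x y => e <= bowen_dist T n x y) E -> (size E <= b)%N) ->
  exists E : seq Omega,
    [/\ pairwise (fun x y => e <= bowen_dist T n x y) E,
        forall x, x \in E -> G x &
        forall y, G y -> exists2 x, x \in E & bowen_dist T n x y < e].
Proof.
move=> e0 Hb.
pose sep (E : seq Omega) := pairwise (fun x y => e <= bowen_dist T n x y) E.
pose P k := `[< exists E, [/\ sep E, forall x, x \in E -> G x & size E = k] >].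
have exP : exists k, P k by exists 0%N; apply/asboolP; exists [::]; split.
have bP k : P k -> (k <= b)%N by case/asboolP=> E [sE _ <-]; exact: Hb.
case: (ex_maxnP exP bP) => k /asboolP[E [sE GE Ek]] kmax.
exists E; split=> // y Gy; apply: contrapT => Hy.
suff : (k.+1 <= k)%N by rewrite ltnn.
apply: kmax; apply/asboolP; exists (y :: E); split=> /=.
- apply/andP; split=> //; apply/allP => x xE.
  rewrite leNgt; apply/negP => yx; apply: Hy; exists x => //.
  by rewrite bowen_dist_sym.
- by move=> x; rewrite inE => /orP[/eqP->//|]; exact: GE.
- by rewrite Ek.
Qed.

End BowenMetric.

Section BowenMeasure.
Context {R : realType} {Omega : pmetricType R} (T : Omega -> Omega).
Variable nu : probability (borelType Omega) R.
Hypothesis Tc : continuous T.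
Local Open Scope ereal_scope.

Lemma measurable_bowen_ball n (x : Omega) e :
  measurable (bowen_ball T n x e : set (borelType Omega)).
Proof. by apply: sub_sigma_algebra; exact: open_bowen_ball. Qed.

(** The balls of half the radius around separated points are disjoint. *)
Lemma separated_measure_le n (e c : R) (E : seq Omega)
    (A : set (borelType Omega)) :
  measurable A ->
  pairwise (fun x y => e <= bowen_dist T n x y)%R E ->
  (forall x, x \in E -> bowen_ball T n x (e / 2) `<=` A) ->
  (forall x, c%:E <= nu (bowen_ball T n x (e / 2))) ->
  ((size E)%:R * c)%:E <= nu A.
Proof.
move=> mA sE EA cnu.
pose U (E : seq Omega) := \big[setU/set0]_(x <- E) bowen_ball T n x (e / 2).
have mU F : measurable (U F : set (borelType Omega)).
  apply: bigsetU_measurable => x _; exact: measurable_bowen_ball.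
have UA : (U E : set (borelType Omega)) `<=` A.
  by rewrite /U -bigcup_seq => y [x /= xE yx]; exact: EA xE _ yx.
apply: le_trans (le_measure nu _ _ UA); rewrite ?inE//.
elim: E sE {EA UA} => [|x E IH]; first by rewrite mul0r.
rewrite pairwise_cons => /andP[/allP xE sE].
rewrite /U big_cons -/(U E) measureU//; last 2 first.
- exact: measurable_bowen_ball.
- rewrite -subset0 => y [/= xy]; rewrite /U -bigcup_seq => -[z /= zE zy].
  have := xE _ zE; rewrite leNgt => /negP; apply.
  apply: le_lt_trans (bowen_dist_triangle T n (y : Omega) x z) _.
  by rewrite [X in (_ < X)%R]splitr ltrD// bowen_dist_sym.
by rewrite /= -natr1 mulrDl mul1r addrC EFinD leeD// IH.
Qed.

Lemma spanning_measure_le n (e c : R) (E : seq Omega)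
    (G : set (borelType Omega)) :
  measurable G ->
  (forall y, G y -> exists2 x, x \in E & bowen_dist T n x y < e)%R ->
  (forall x, nu (bowen_ball T n x e) <= c%:E) ->
  nu G <= ((size E)%:R * c)%:E.
Proof.
move=> mG GE cnu.
pose U (E : seq Omega) := \big[setU/set0]_(x <- E) bowen_ball T n x e.
have mU F : measurable (U F : set (borelType Omega)).
  apply: bigsetU_measurable => x _; exact: measurable_bowen_ball.
have GU : G `<=` (U E : set (borelType Omega)).
  by rewrite /U -bigcup_seq => y /GE[x xE xy]; exists x.
apply: le_trans (le_measure nu _ _ GU) _; rewrite ?inE//.
elim: E {GE GU} => [|x E IH]; first by rewrite /U big_nil measure0 mul0r.
rewrite /U big_cons -/(U E).
apply: le_trans (measureU2 _ _ _) _ => //; first exact: measurable_bowen_ball.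
by rewrite /= -natr1 mulrDl mul1r addrC EFinD leeD// IH.
Qed.

(** The lower bound on the measure of Bowen balls bounds the cardinality of
separated sets, which makes a maximal one exist. *)
Lemma ahlfors_bowen_separated h n (e : R) (G : set Omega) :
  ahlfors_bowen T nu h -> (0 < n)%N -> (0 < e)%R ->
  exists E : seq Omega,
    [/\ pairwise (fun x y => e <= bowen_dist T n x y)%R E,
        forall x, x \in E -> G x &
        forall y, G y -> exists2 x, x \in E & (bowen_dist T n x y < e)%R].
Proof.
move=> [h0 AB] n0 e0.
have [|C C0 HC] := AB (e / 2)%R; first by rewrite divr_gt0.
pose c := (C^-1 * expR (- (n%:R * h)))%R.
have c0 : (0 < c)%R by rewrite mulr_gt0 ?invr_gt0 ?expR_gt0.
apply: (@maximal_separated _ _ _ _ _ _ (Num.truncn c^-1)) => // E sE.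
have := @separated_measure_le n e c E setT measurableT sE.
rewrite probability_setT lee_fin => H.
have {H} : ((size E)%:R * c <= 1)%R.
  by apply: H => // x; have [] := HC n x n0.
rewrite -ler_pdivlMr// div1r => H.
by rewrite truncn_ge_nat// invr_ge0 ltW.
Qed.

End BowenMeasure.

(** * Large deviation estimates *)

Section Rates.
Context {R : realType}.
Local Open Scope ereal_scope.

Lemma limn_einf_gt (u : (\bar R)^nat) a : a < limn_einf u ->
  exists N, forall n, (N <= n)%N -> a < u n.
Proof.
rewrite limn_einf_lim (cvg_lim _ (@cvg_einfs_sup _ u))//.
move=> /ereal_sup_gt[_ [N _ <-]] aN.
exists N => n Nn; apply: lt_le_trans aN _.
by apply: ereal_inf_lbound; exists n.
Qed.

Lemma limn_esup_lt (u : (\bar R)^nat) a : limn_esup u < a ->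
  exists N, forall n, (N <= n)%N -> u n < a.
Proof.
rewrite limn_esup_lim (cvg_lim _ (@cvg_esups_inf _ u))//.
move=> /ereal_inf_lt[_ [N _ <-]] aN.
exists N => n Nn; apply: le_lt_trans aN.
by apply: ereal_sup_ubound; exists n.
Qed.

Lemma lne_rate_ge (p : \bar R) n (b : R) : p \is a fin_num -> (0 < n)%N ->
  (- b)%:E < (n%:R^-1)%:E * lne p -> (expR (- (n%:R * b)))%:E <= p.
Proof.
move: p => [p| |]// _ n0.
have n0' : (0 < n%:R^-1 :> R)%R by rewrite invr_gt0 ltr0n.
have [p0|p0] := leP p 0%R.
  by rewrite le0_lneNy ?lee_fin// gt0_muleNy.
rewrite lne_EFin// -EFinM lte_fin lee_fin => H.
rewrite -(lnK p0) ler_expR -mulrN -ler_pdivlMl ?ltr0n//.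
by rewrite ltW.
Qed.

Lemma lne_rate_le (p : \bar R) n (b : R) : p \is a fin_num -> (0 < n)%N ->
  (n%:R^-1)%:E * lne p < (- b)%:E -> p <= (expR (- (n%:R * b)))%:E.
Proof.
move: p => [p| |]// _ n0.
have n0' : (0 < n%:R^-1 :> R)%R by rewrite invr_gt0 ltr0n.
have [p0|p0] := leP p 0%R; first by rewrite lee_fin (le_trans p0)// expR_ge0.
rewrite lne_EFin// -EFinM lte_fin lee_fin => H.
rewrite -[leLHS](lnK p0) ler_expR -mulrN -ler_pdivrMl ?ltr0n//.
by rewrite ltW.
Qed.

End Rates.

Section LargeDeviations.
Context {R : realType} {Omega : pmetricType R}.
Variables (nu : probability (borelType Omega) R) (X : nat -> Omega -> R).
Variable I : R -> \bar R.
Hypothesis X_measurable : forall n, (0 < n)%N ->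
  measurable_fun [set: borelType Omega] (X n).
Hypothesis X_LDP : LDP nu X I.
Local Open Scope ereal_scope.

Lemma measurable_average_preimage n (E : set R) : (0 < n)%N -> measurable E ->
  measurable ([set x | E (X n x / n%:R)%R] : set (borelType Omega)).
Proof.
move=> n0 mE.
have mf : measurable_fun [set: borelType Omega] (fun x => X n x / n%:R)%R.
  by apply: measurable_funM => //; exact: X_measurable.
by have := mf measurableT _ mE; rewrite setTI.
Qed.

Lemma measurable_deviation_lt n (a eta : R) : (0 < n)%N -> measurable
  ([set x | `|X n x / n%:R - a| < eta]%R : set (borelType Omega)).
Proof.
move=> n0; rewrite (_ : [set x | _] =
    [set x | `](a - eta)%R, (a + eta)%R[%classic (X n x / n%:R)%R]).
  by apply: measurable_average_preimage => //; exact: measurable_itv.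
by apply/seteqP; split => x /=; rewrite in_itv /= ltr_distl.
Qed.

Lemma measurable_deviation_le n (a eta : R) : (0 < n)%N -> measurable
  ([set x | `|X n x / n%:R - a| <= eta]%R : set (borelType Omega)).
Proof.
move=> n0; rewrite (_ : [set x | _] =
    [set x | `[(a - eta)%R, (a + eta)%R]%classic (X n x / n%:R)%R]).
  by apply: measurable_average_preimage => //; exact: measurable_itv.
by apply/seteqP; split => x /=; rewrite in_itv /= ler_distl.
Qed.

(** The large deviations lower bound applied to an open ball around [a], where
the infimum of the rate is at most [I a]. *)
Lemma LDP_lower (a b eta : R) : I a < b%:E -> (0 < eta)%R ->
  exists N, forall n, (N <= n)%N ->
    (expR (- (n%:R * b)))%:E <= nu [set x | `|X n x / n%:R - a| < eta]%R.
Proof.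
move=> Iab eta0; have [_ /(_ (ball a eta))] := X_LDP.
case=> [|+ _ _]; first by apply: open_measurable; exact: ball_open.
rewrite ((interior_id _).1 (ball_open a eta)) => H.
have dev n : [set x | ball a eta (X n x / n%:R)%R] =
    [set x | `|X n x / n%:R - a| < eta]%R.
  by apply/seteqP; split => x /=; rewrite /ball /= distrC.
have : (- b)%:E < limn_einf (fun n =>
    ((n%:R^-1)%:E * lne (nu [set x | ball a eta (X n x / n%:R)%R]))%E).
  apply: lt_le_trans H; rewrite EFinN lteN2; apply: le_lt_trans Iab.
  by apply: ereal_inf_lbound; exists a => //; exact: ballxx.
move=> /limn_einf_gt[N HN]; exists N.+1 => n Nn.
have n0 : (0 < n)%N by exact: leq_ltn_trans Nn.
apply: lne_rate_ge => //; last by rewrite -dev; exact/HN/ltnW.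
by apply: fin_num_measure; exact: measurable_deviation_lt.
Qed.

(** Lower semicontinuity keeps the rate above some [b' > b] on a closed ball
around [a], to which the large deviations upper bound applies. *)
Lemma LDP_upper (a b : R) : b%:E < I a ->
  exists2 eta : R, (0 < eta)%R & exists N, forall n, (N <= n)%N ->
    nu [set x | `|X n x / n%:R - a| <= eta]%R <= (expR (- (n%:R * b)))%:E.
Proof.
move=> bIa; have [[Ilsc I0] ldp] := X_LDP.
have [b' bb' b'Ia] : exists2 b', b%:E < b'%:E & b'%:E < I a.
  case: (I a) bIa => [r| |]//.
  - rewrite lte_fin => br; exists ((b + r) / 2)%R; rewrite lte_fin.
      by rewrite midf_lt.
    by rewrite midf_lt.
  - by move=> _; exists (b + 1)%R; rewrite ?ltry// lte_fin ltrDl.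
have [V Va HV] := Ilsc a b' b'Ia.
have [eta eta0 etaV] : exists2 eta : R, (0 < eta)%R &
    closed_ball a eta `<=` V.
  move: Va; rewrite -nbhs_ballE => -[e /= e0 eV].
  exists (e / 2)%R; first by rewrite divr_gt0.
  apply: subset_trans eV; apply: closed_ball_subset; first by rewrite divr_gt0.
  by rewrite ltr_pdivrMr// ltr_pMr// ltr1n.
exists eta => //; have [] := ldp (closed_ball a eta).
  by apply: closed_measurable; exact: closed_ball_closed.
move=> _ _; rewrite -(closure_id _).1; last exact: closed_ball_closed.
move=> H.
have dev n : [set x | closed_ball a eta (X n x / n%:R)%R] =
    [set x | `|X n x / n%:R - a| <= eta]%R.
  apply/seteqP; split => x /=.
    by rewrite closed_ballE// /closed_ball_ /= distrC.
  by rewrite closed_ballE// /closed_ball_ /= distrC.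
have /limn_esup_lt[N HN] : limn_esup (fun n =>
    ((n%:R^-1)%:E * lne (nu [set x | closed_ball a eta (X n x / n%:R)%R]))%E)
    < (- b)%:E.
  apply: le_lt_trans H _; rewrite EFinN lteN2; apply: lt_le_trans bb' _.
  apply: le_ereal_inf_tmp => _ [t /etaV/HV + <-]; exact: ltW.
exists N.+1 => n Nn; have n0 : (0 < n)%N by exact: leq_ltn_trans Nn.
apply: lne_rate_le => //; last by rewrite -dev; exact/HN/ltnW.
by apply: fin_num_measure; exact: measurable_deviation_le.
Qed.

End LargeDeviations.

(** * Shadowing *)

Section Shadowing.
Context {R : realType} {Omega : metricType R} (T : Omega -> Omega).

(** The time at which the [j]-th block starts, consecutive blocks being
separated by a gap [M]. *)
Definition start (M : nat) (len : nat -> nat) (j : nat) : nat :=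
  (\sum_(i < j) (len i + M))%N.

Lemma startS M len j : start M len j.+1 = (start M len j + (len j + M))%N.
Proof. by rewrite /start big_ord_recr. Qed.

Lemma startSl M len j :
  start M len j.+1 = (start M (fun i => len i.+1) j + (len 0 + M))%N.
Proof. by rewrite /start big_ord_recl addnC. Qed.

Variables (M : nat) (e : R).
Hypothesis exact_e : forall n x, (0 < n)%N ->
  iter (n + M) T @` bowen_ball T n x e = setT.

(** By induction from the last block: [iter (len 0 + M) T] maps the Bowen ball
of the first block onto the space, hence onto a point shadowing the others. *)
Lemma shadowing_fin k (len : nat -> nat) (pts : nat -> Omega) :
  (forall j, (0 < len j)%N) ->
  exists y, forall j, (j < k)%N ->
    bowen_dist T (len j) (iter (start M len j) T y) (pts j) < e.
Proof.
elim: k len pts => [|k IH] len pts len0; first by exists (pts 0%N).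
have [y' Hy'] := IH (fun j => len j.+1) (fun j => pts j.+1) (fun=> len0 _).
have [y xy yy'] : (iter (len 0 + M) T @` bowen_ball T (len 0) (pts 0%N) e) y'.
  by rewrite exact_e.
exists y => -[_|j jk].
  by rewrite /start big_ord0 /= bowen_dist_sym.
by rewrite startSl iterD yy'; exact: Hy'.
Qed.

(** Compactness upgrades shadowing of finitely many blocks to infinitely many,
at the price of closed Bowen balls. *)
Lemma shadowing (len : nat -> nat) (pts : nat -> Omega) :
  compact [set: Omega] -> continuous T -> (forall j, (0 < len j)%N) ->
  exists y, forall j,
    bowen_dist T (len j) (iter (start M len j) T y) (pts j) <= e.
Proof.
move=> cT Tc len0.
have /choice[y Hy] := fun k => @shadowing_fin k len pts len0.
have [z [_ zy]] := cT (y @ \oo) _ filterT.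
exists z => j; apply/ler_addgt0Pl => eta eta0.
have [_ [/= [k /= jk <-] zk]] :=
  zy [set y k | k in [set k | (j < k)%N]] _
    (ltac:(exists j.+1 => // k /= jk; exists k => //))
    (near_bowen_dist (start M len j + len j) z Tc eta0).
apply: le_trans (bowen_dist_triangle _ _ (iter (start M len j) T (y k)) _ _) _.
apply: lerD; last exact/ltW/Hy.
by apply: le_trans (ltW zk); exact: bowen_dist_shift.
Qed.

End Shadowing.

(** * Averages along shadowing orbits *)

Section Sublinear.
Context {R : realType}.

Lemma natmul_ge (x k : R) : 0 < k ->
  exists N, forall n, (N <= n)%N -> x <= k * n%:R.
Proof.
move=> k0; exists (Num.bound `|x / k|) => n Nn.
rewrite -ler_pdivrMl// mulrC; apply: le_trans (ler_norm _) _.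
by apply/ltW/(lt_le_trans (archi_boundP _)) => //; rewrite ler_nat.
Qed.

Lemma expR_decay (k z : R) : 0 < k -> 0 < z ->
  exists N, forall n, (N <= n)%N -> expR (- (n%:R * k)) <= z.
Proof.
move=> k0 z0; have [N HN] := natmul_ge (- ln z) k0.
exists N => n /HN H; rewrite -[leRHS](lnK (z0 : z \is Num.pos)) ler_expR.
by rewrite lerNl mulrC.
Qed.

Lemma partial_sums_bounded (G : nat -> R) i0 :
  (forall i, (i0 <= i)%N -> G i <= 0) ->
  exists C, forall j, \sum_(i < j) G i <= C.
Proof.
move=> G0; exists (\big[Num.max/0]_(j < i0.+1) \sum_(i < j) G i).
elim=> [|j IH]; first by rewrite big_ord0; exact: bigmax_ge_id.
have [ji0|i0j] := ltnP j i0.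
  exact: (le_bigmax _ (fun j : 'I_i0.+1 => \sum_(i < j) G i)
    (Ordinal (ji0 : (j.+1 < i0.+1)%N))).
by rewrite big_ord_recr /=; apply: le_trans IH; rewrite gerDl G0.
Qed.

Lemma sum_sublinear_le (F : nat -> R) (l : nat -> nat) (k : R) i0 :
  (forall i, (i0 <= i)%N -> F i <= k * (l i)%:R) ->
  exists C, forall j, \sum_(i < j) F i <= C + k * (\sum_(i < j) l i)%:R.
Proof.
move=> Fk.
have [|C HC] := @partial_sums_bounded (fun i => F i - k * (l i)%:R) i0.
  by move=> i /Fk; rewrite subr_le0.
exists C => j; rewrite -lerBlDr; apply: le_trans (HC j).
by rewrite sumrB lerB// natr_sum mulr_sumr.
Qed.

End Sublinear.

Lemma start_split M len n : (0 < n)%N -> (forall j, (0 < len j)%N) ->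
  exists j m, [/\ n = (start M len j + m)%N, (0 < m)%N & (m <= len j + M)%N].
Proof.
move=> + len0; elim: n => // -[|n] IH _.
  by exists 0%N, 1%N; rewrite /start big_ord0; split=> //; rewrite ltn_addr.
have [//|j [m [-> m0 mj]]] := IH.
have [mj'|jm] := ltnP m (len j + M).
  by exists j, m.+1; rewrite addnS.
exists j.+1, 1%N; rewrite startS addn1; split=> //; last by rewrite ltn_addr.
by rewrite (_ : m = (len j + M)%N)//; apply/eqP; rewrite eqn_leq mj.
Qed.

Section Averages.
Context {R : realType} {Omega : metricType R} (T : Omega -> Omega).
Variable X : nat -> Omega -> R.

Lemma weak_bowen_le : weak_bowen T X -> exists2 delta : R, 0 < delta &
  forall k, 0 < k -> exists N, forall n, (N <= n)%N -> forall x y,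
    bowen_dist T n x y <= delta -> `|X n x - X n y| <= k * n%:R.
Proof.
move=> [delta d0 /fine_cvgP[fino /cvgrPdist_le lim0]].
exists delta => // k k0; have [N1 _ HN1] := fino.
have [N2 _ HN2] := lim0 _ k0.
exists (maxn 1 (maxn N1 N2)) => n.
rewrite !geq_max => /and3P[n0 nN1 nN2] x y xy.
have := HN2 _ nN2; have := HN1 _ nN1.
rewrite /= sub0r normrN; set v := (_ * oscillation _ _ _ _)%E => /fineK vE vk.
rewrite mulrC -ler_pdivrMl ?ltr0n// -lee_fin.
apply: (@le_trans _ _ v); last by rewrite -vE lee_fin (le_trans (ler_norm _)).
rewrite EFinM lee_pmul2l// ?lte_fin ?invr_gt0 ?ltr0n//.
by apply: ereal_sup_ubound; exists (x, y).
Qed.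

Variable A : nat -> R.
Hypothesis A_sublinear : A n / n%:R @[n --> \oo] --> 0.
Hypothesis A_additive : forall x n m, (0 < n)%N -> (0 < m)%N ->
  `|X (n + m)%N x - X n x - X m (iter n T x)| <= A n.

Lemma sublinear_le (k : R) : 0 < k ->
  exists N, forall n, (N <= n)%N -> A n <= k * n%:R.
Proof.
move=> k0; have /cvgrPdist_le/(_ _ k0)[N _ HN] := A_sublinear.
exists (maxn 1 N) => n; rewrite geq_max => /andP[n0 nN].
rewrite -ler_pdivrMr ?ltr0n//; apply: le_trans (ler_norm _) _.
by have := HN n nN; rewrite /= sub0r normrN.
Qed.

(** A bounded oscillation over a finite spanning set bounds [X n] for large [n];
almost additivity transfers the bound to [X 1] and then, by summation along
orbits, to all [X m] linearly. *)
Lemma additive_linear_bound (delta : R) :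
  (forall n, (0 < n)%N -> exists E : seq Omega, forall y,
     exists2 x, x \in E & bowen_dist T n x y < delta) ->
  (exists N, forall n, (N <= n)%N -> forall x y,
    bowen_dist T n x y <= delta -> `|X n x - X n y| <= n%:R) ->
  exists2 K, 0 <= K & forall m x, (0 < m)%N -> `|X m x| <= K * m%:R.
Proof.
move=> span [N HN].
have bnd n : (N <= n)%N -> (0 < n)%N -> exists B, forall x, `|X n x| <= B.
  move=> Nn n0; have [E HE] := span n n0.
  exists (\sum_(x <- E) `|X n x| + n%:R) => y.
  have [x xE xy] := HE y.
  have := HN n Nn x y (ltW xy) => H.
  have H2 : `|X n x| <= \sum_(x <- E) `|X n x|.
    rewrite (big_rem x xE) /= lerDl.
    by elim/big_rec: _ => // z s _ s0; rewrite addr_ge0.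
  move: H H2; set S := \sum_(_ <- _) _; rewrite !ler_norml; lra.
have [B1 HB1] := bnd N.+1 (leqnSn _) isT.
have [B2 HB2] := bnd N.+2 (leq_trans (leqnSn _) (leqnSn _)) isT.
pose K1 := A 1 + B1 + B2.
have X1 x : `|X 1%N x| <= K1.
  have := A_additive x (isT : (0 < 1)%N) (isT : (0 < N.+1)%N).
  have := HB1 (iter 1 T x); have := HB2 x.
  rewrite add1n /K1 !ler_norml; lra.
exists (`|K1| + `|A 1|); first by rewrite addr_ge0.
have K1le := ler_norm K1; have A1le := ler_norm (A 1).
elim=> // -[|m] IH x _.
  by rewrite mulr1 (le_trans (X1 x))//; have := normr_ge0 (A 1); lra.
have := A_additive x (isT : (0 < 1)%N) (isT : (0 < m.+1)%N).
have := IH (iter 1 T x) isT; have := X1 x.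
rewrite add1n -(natr1 m.+1) mulrDr mulr1.
set B := _ * m.+1%:R; rewrite !ler_norml; lra.
Qed.

Section Blocks.
Variables (M : nat) (len : nat -> nat) (y : Omega).
Hypotheses (M0 : (0 < M)%N) (len0 : forall j, (0 < len j)%N).
Local Notation z j := (iter (start M len j) T y).

(** The error allowed by almost additivity depends on the length of the first of
two blocks, so blocks are split off from the front. *)
Lemma additive_blocks j m : (0 < m)%N ->
  `|X (start M len j + m)%N y - X m (z j) -
    \sum_(i < j) (X (len i) (z i) + X M (iter (len i) T (z i)))| <=
  \sum_(i < j) (A (len i) + A M).
Proof.
elim: j m => [|j IH] m m0.
  by rewrite /start !big_ord0 subr0 /= add0n subrr normr0.
have := IH (len j + (M + m))%N; rewrite !addn_gt0 len0 => /(_ isT).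
have := A_additive (z j) (len0 j) (ltn_addr m M0).
have := A_additive (iter (len j) T (z j)) M0 m0.
have -> : iter M T (iter (len j) T (z j)) = z j.+1.
  by rewrite -!iterD startS; congr (iter _ T y); lia.
have -> : (start M len j.+1 + m = start M len j + (len j + (M + m)))%N.
  by rewrite startS; lia.
rewrite !big_ord_recr /= !ler_norml.
set S1 := \sum_(i < j) _; set S2 := \sum_(i < j) _; lra.
Qed.

(** The error accumulated over complete blocks is a sum of terms [F i] that are
sublinear in [len i]; since block lengths increase by one, the length of the
block in progress is itself such a sum, up to a constant. *)
Lemma level_set_blocks (a K : R) (n0 : nat) : 0 <= K ->
  (forall i, len i = (n0 + i)%N) ->
  (forall m x, (0 < m)%N -> `|X m x| <= K * m%:R) ->
  (forall k, 0 < k -> exists i0, forall i, (i0 <= i)%N ->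
    `|X (len i) (z i) - a * (len i)%:R| <= k * (len i)%:R) ->
  level_set X a y.
Proof.
move=> K0 lenE HK Hz.
pose L := K + `|a|; have L0 : 0 <= L by rewrite addr_ge0.
have Xa m x : (0 < m)%N -> `|X m x - a * m%:R| <= L * m%:R.
  move=> m0; apply: le_trans (ler_normB _ _) _.
  by rewrite mulrDl lerD ?HK// normrM normr_nat.
pose c := A M + L * (M%:R + 1).
pose F i := `|X (len i) (z i) - a * (len i)%:R| + A (len i) + c.
have dev j m : (0 < m)%N -> (m <= len j + M)%N ->
    `|X (start M len j + m)%N y - a * (start M len j + m)%:R| <=
    L * (n0 + M)%:R + \sum_(i < j) F i.
  move=> m0 mj; have := additive_blocks j m0.
  have := Xa m (z j) m0.
  have : L * m%:R <= L * (n0 + M)%:R + \sum_(i < j) L.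
    rewrite sumr_const card_ord -(mulr_natr L) -mulrDr ler_wpM2l//.
    by rewrite -natrD ler_nat; move: mj; rewrite lenE; lia.
  have : `|\sum_(i < j) (X (len i) (z i) + X M (iter (len i) T (z i))) -
           a * (start M len j)%:R| <=
         \sum_(i < j) (`|X (len i) (z i) - a * (len i)%:R| + L * M%:R).
    rewrite /start natr_sum mulr_sumr -sumrB.
    apply: le_trans (ler_norm_sum _ _ _) _; apply: ler_sum => i _.
    have := Xa M (iter (len i) T (z i)) M0.
    rewrite natrD mulrDr; set u := X (len i) _; set v := X M _.
    move=> H.
    apply: (@le_trans _ _ `|(u - a * (len i)%:R) + (v - a * M%:R)|).
      by rewrite le_eqVlt; apply/orP; left; apply/eqP; congr `|_|; ring.
    by apply: le_trans (ler_normD _ _) _; rewrite lerD2l.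
  have -> : \sum_(i < j) F i =
     \sum_(i < j) (`|X (len i) (z i) - a * (len i)%:R| + L * M%:R) +
     \sum_(i < j) (A (len i) + A M) + \sum_(i < j) L.
    by rewrite -!big_split /=; apply: eq_bigr => i _; rewrite /F /c; ring.
  rewrite natrD mulrDr.
  set S1 := \sum_(_ < _) _; set S2 := \sum_(_ < _) _.
  set S3 := \sum_(_ < _) _; set S4 := \sum_(_ < _) _.
  rewrite !ler_norml; lra.
have sumF k : 0 < k -> exists C, forall n, (0 < n)%N ->
    `|X n y - a * n%:R| <= C + k * n%:R.
  move=> k0; have k30 : 0 < k / 3 by rewrite divr_gt0.
  have [N1 HN1] := Hz _ k30; have [N2 HN2] := sublinear_le k30.
  have [N3 HN3] := natmul_ge c k30.
  have [|C HC] := @sum_sublinear_le R F len k (maxn N1 (maxn N2 N3)).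
    move=> i; rewrite !geq_max => /and3P[/HN1 + iN2 iN3].
    have := HN2 (len i); rewrite {1}lenE => /(_ (leq_trans iN2 (leq_addl _ _))).
    have := HN3 (len i); rewrite {1}lenE => /(_ (leq_trans iN3 (leq_addl _ _))).
    by rewrite /F; lra.
  exists (C + L * (n0 + M)%:R) => n n0'.
  have [j [m [-> m0 mj]]] := start_split M n0' len0.
  apply: le_trans (dev j m m0 mj) _.
  rewrite [leRHS]addrAC [leLHS]addrC lerD2r; apply: le_trans (HC j) _.
  rewrite lerD2l ler_wpM2l ?(ltW k0)// ler_nat.
  apply: (@leq_trans (start M len j)); last exact: leq_addr.
  by rewrite /start; apply: leq_sum => i _; exact: leq_addr.
rewrite /level_set /=; apply/cvgrPdist_le => k k0.
have k20 : 0 < k / 2 by rewrite divr_gt0.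
have [C HC] := sumF _ k20.
have [N HN] := natmul_ge C k20.
exists N.+1 => // n /= Nn; have n0' : (0 < n)%N by exact: leq_ltn_trans Nn.
rewrite distrC -(@ler_pM2r _ n%:R) ?ltr0n// -{2}(normr_nat R n) -normrM.
rewrite mulrBl divfK ?pnatr_eq0 -?lt0n//.
apply: le_trans (HC n n0') _.
have := HN n (ltnW Nn); lra.
Qed.

End Blocks.

End Averages.

(** * Entropy of subsets *)

Section Series.
Context {R : realType}.
Local Open Scope ereal_scope.

Lemma nneseries_ge_term (f : nat -> \bar R) i : (forall i, 0 <= f i) ->
  f i <= \sum_(k <oo) f k.
Proof.
move=> f0; apply: le_trans (nneseries_lim_ge i.+1 _); last by [].
by rewrite big_nat_recr//= leeDr// sume_ge0.
Qed.

Lemma nneseries_pairs (f : nat -> nat * nat) (a : nat -> nat -> \bar R) :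
  set_bij setT setT f -> (forall k l, 0 <= a k l) ->
  \sum_(i <oo) a (f i).1 (f i).2 = \sum_(k <oo) \sum_(l <oo) a k l.
Proof.
move=> bf a0.
rewrite nneseries_esumT// -(reindex_esum _ _ f (fun p => a p.1 p.2) bf).
rewrite nneseries_esumT; last by move=> k; exact: nneseries_ge0.
under [RHS]eq_esum do rewrite nneseries_esumT//.
rewrite esum_esum//; congr esum.
by apply/seteqP; split.
Qed.

Lemma sum_exclusive_le (U : eqType) (s : seq U) (a : pred U) (w : R) :
  (0 <= w)%R -> pairwise (fun x y => ~~ (a x && a y)) s ->
  \sum_(x <- s) (if a x then w%:E else 0) <= w%:E.
Proof.
move=> w0; elim: s => [|x s IH]; first by rewrite big_nil lee_fin.
rewrite pairwise_cons big_cons => /andP[xs /IH{}IH].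
case: ifP xs => ax; last by rewrite add0e.
move=> /allP xs; rewrite big1_seq ?adde0// => y /= ys.
by have /= /negbTE -> := xs _ ys.
Qed.

End Series.

Section Htop.
Context {R : realType} {Omega : metricType R} (T : Omega -> Omega).
Implicit Types (Z : set Omega).

Lemma htop_le Z c : (forall e, 0 < e -> (entropy_at T Z e <= c)%E) ->
  (htop T Z <= c)%E.
Proof.
move=> H; apply: lime_le; first exact: is_cvg_entropy_at.
near=> e; apply: H; near: e; exact: nbhs_right_gt.
Unshelve. all: by end_near. Qed.

Lemma htop_ge Z c e : 0 < e -> (c <= entropy_at T Z e)%E -> (c <= htop T Z)%E.
Proof.
move=> e0 H; apply: lime_ge; first exact: is_cvg_entropy_at.
near=> d; apply: le_trans H _; apply: entropy_at_nonincreasing.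
by near: d; apply: nbhs_right_le.
Unshelve. all: by end_near. Qed.

Lemma entropy_at_le Z e t : (forall N, bowen_outer T Z t e N = 0%E) ->
  (entropy_at T Z e <= t%:E)%E.
Proof.
move=> H; apply: ereal_inf_lbound; exists t => //=.
rewrite /bowen_outer_lim (_ : (fun N => _) = cst 0%E) ?lim_cst//.
exact/funext.
Qed.

Lemma entropy_at_ge Z e (c : R) :
  (forall t, t < c -> exists2 k : R, 0 < k &
    forall N, (k%:E <= bowen_outer T Z t e N)%E) ->
  (c%:E <= entropy_at T Z e)%E.
Proof.
move=> H; apply: le_ereal_inf_tmp => _ [t /= t0 <-]; rewrite lee_fin leNgt.
apply/negP => /H[k k0 Hk].
have : (k%:E <= bowen_outer_lim T Z t e)%E.
  by apply: lime_ge; [exact: is_cvg_bowen_outer|exact: nearW].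
by rewrite t0 lee_fin leNgt k0.
Qed.

(** For a nonpositive exponent every single ball weighs at least [1]. *)
Lemma bowen_outer_nonpos Z t e N : Z !=set0 -> t <= 0 ->
  (1%:E <= bowen_outer T Z t e N)%E.
Proof.
move=> Z0 t0; rewrite /bowen_outer; case: ifPn => [/eqP ZE|_].
  by move: Z0; rewrite ZE => -[].
apply: le_ereal_inf_tmp => _ [c _ <-].
apply: le_trans (nneseries_ge_term 0 _) => [|i]; last first.
  by rewrite lee_fin expR_ge0.
by rewrite lee_fin -expR0 ler_expR oppr_ge0 mulr_ge0_le0.
Qed.

(** The cover infimum ranges over infinite sequences; finite families are padded
with balls so long that they weigh almost nothing, which needs [0 < t]. *)
Lemma bowen_outer_eq0 Z t e N : 0 < t ->
  (forall zeta, 0 < zeta -> exists F : nat -> seq (nat * Omega),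
    [/\ forall k p, p \in F k -> (N <= p.1)%N,
        forall z, Z z -> exists k, exists2 p, p \in F k &
          bowen_ball T p.1 p.2 e z &
        forall k, \sum_(p <- F k) expR (- (p.1%:R * t)) <=
          zeta / (2 ^ k.+1)%:R]) ->
  bowen_outer T Z t e N = 0%E.
Proof.
move=> t0 H; apply/eqP; rewrite eq_le bowen_outer_ge0 andbT.
apply/lee_addgt0Pr => zeta zeta0; rewrite add0e /bowen_outer.
case: ifPn => [_|/set0P[pt _]]; first by rewrite lee_fin ltW.
have z20 : 0 < zeta / 2 by rewrite divr_gt0.
have [F [FN ZF Fsum]] := H _ z20.
have long (r : R) : 0 < r -> exists L, (N <= L)%N /\ expR (- (L%:R * t)) <= r.
  move=> r0; have [N' HN'] := expR_decay t0 r0; exists (maxn N N').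
  by split; [exact: leq_maxl|exact/HN'/leq_maxr].
have dy_gt0 k : (0 : R) < (2 ^ k)%:R by rewrite ltr0n expn_gt0.
have /choice[L HL] := fun kl : nat * nat =>
  long _ (divr_gt0 (divr_gt0 z20 (dy_gt0 kl.1.+1)) (dy_gt0 kl.2.+1)).
pose d k l :=
  if (l < size (F k))%N then nth (N, pt) (F k) l else (L (k, l), pt).
pose w (p : nat * Omega) : \bar R := (expR (- (p.1%:R * t)))%:E.
have w0 p : (0 <= w p)%E by rewrite lee_fin expR_ge0.
have /card_esym/ppcard_eqP[f] := card_nat2.
apply: (@le_trans _ _ (\sum_(i <oo) w (d (f i).1 (f i).2))%E).
  apply: ereal_inf_lbound; exists (fun i => d (f i).1 (f i).2) => //; split.
    move=> i; rewrite /d; case: ifP => [ls|_]; last first.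
      by have [] := HL ((f i).1, (f i).2).
    exact/(FN (f i).1)/mem_nth.
  move=> z /ZF[k [p pF pz]]; exists (f^-1%FUN (k, index p (F k))) => //.
  by rewrite invK ?inE//= /d index_mem pF nth_index.
rewrite (nneseries_pairs (a := fun k l => w (d k l)))//.
apply: le_trans (epsilon_trick0 xpredT (ltW zeta0)).
apply: lee_nneseries => [k _ _|k _]; first exact: nneseries_ge0.
pose g l := if (l < size (F k))%N then w (nth (N, pt) (F k) l) else 0%E.
have g0 l : (0 <= g l)%E by rewrite /g; case: ifP.
pose zk := zeta / 2 / (2 ^ k.+1)%:R.
have zk0 : 0 <= zk by rewrite divr_ge0// ltW.
apply: (@le_trans _ _ (\sum_(l <oo) (g l + (zk / (2 ^ l.+1)%:R)%:E))%E).
  apply: lee_nneseries => // l _; rewrite /d /g; case: ifP => _.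
    by rewrite leeDl// lee_fin divr_ge0.
  by rewrite add0e lee_fin; have [] := HL (k, l).
apply: le_trans (epsilon_trick xpredT g0 zk0) _.
have -> : (zeta / (2 ^ k.+1)%:R = zk + zk).
  by rewrite /zk -mulrDl -splitr.
rewrite EFinD leeD2r//.
apply: (@le_trans _ _ (\sum_(p <- F k) expR (- (p.1%:R * t)))%:E); last first.
  by rewrite lee_fin Fsum.
rewrite (nneseries_split 0 (size (F k)))// add0n eseries0 ?adde0; last first.
  by move=> l ls _; rewrite /g ltnNge ls.
rewrite (big_nth (N, pt)) -sumEFin big_nat [leRHS]big_nat.
by apply: lee_sum => l /= ls; rewrite /g ls.
Qed.

End Htop.

Section Moran.
Context {R : realType} {Omega : metricType R} (T : Omega -> Omega).
Variables (M n0 : nat) (e r t t1 : R) (E : nat -> seq Omega).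
Local Notation len j := (n0 + j)%N.
Local Notation start := (start M (fun j => len j)).
Hypothesis n0_gt0 : (0 < n0)%N.
Hypothesis t_ge0 : 0 <= t.
Hypothesis n0_large : t * (1 + M%:R) <= (t1 - t) * n0%:R.
Hypothesis E_sep : forall j,
  pairwise (fun x y => 2 * r + 2 * e <= bowen_dist T (len j) x y) (E j).
Hypothesis E_size : forall j, expR (t1 * (len j)%:R) <= (size (E j))%:R.
Variable Z : set Omega.
Hypothesis Z_shadow : forall pts : nat -> Omega, (forall j, pts j \in E j) ->
  exists2 y, Z y &
    forall j, bowen_dist T (len j) (iter (start j) T y) (pts j) <= e.

Let c := t * (n0 + M)%:R.
Let theta j : R := expR (- c) / \prod_(i < j) (size (E i))%:R.

Let size_gt0 j : (0 : R) < (size (E j))%:R.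
Proof. by apply: lt_le_trans (E_size j); exact: expR_gt0. Qed.

Let t_le_t1 : t <= t1.
Proof.
rewrite -subr_ge0 -(@pmulr_lge0 _ n0%:R) ?ltr0n//.
by apply: le_trans n0_large; rewrite mulr_ge0// addr_ge0.
Qed.

(** By the size condition on [n0], the increment of the left-hand side is at
most that of the right-hand side. *)
Let start_growth j : t * (start j.+1)%:R <= c + t1 * \sum_(i < j) (len i)%:R.
Proof.
elim: j => [|j IH].
  by rewrite startS /start !big_ord0 mulr0 addr0 addn0 add0n.
rewrite startS natrD mulrDr big_ord_recr /= mulrDr addrA lerD//.
have : (t1 - t) * n0%:R <= (t1 - t) * (len j)%:R.
  by rewrite ler_wpM2l ?subr_ge0// ler_nat leq_addr.
have -> : (n0 + j.+1 + M)%N = (len j + (1 + M))%N by lia.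
move: n0_large; rewrite !natrD; lra.
Qed.

(** Up to the factor [expR (- c)], [theta j] is the weight of one choice of the
first [j] blocks; no ball of length at most [start j.+1] weighs less. *)
Let theta_le j : theta j <= expR (- (t * (start j.+1)%:R)).
Proof.
rewrite /theta ler_pdivrMr ?prodr_gt0//.
have E_prod : expR (t1 * \sum_(i < j) (len i)%:R) <=
    \prod_(i < j) (size (E i))%:R.
  rewrite mulr_sumr expR_sum; apply: ler_prod => i _.
  by rewrite expR_ge0 E_size.
apply: le_trans (ler_wpM2l (expR_ge0 _) E_prod).
by rewrite -expRD ler_expR; have := start_growth j; lra.
Qed.

(** A Kraft-type argument.  Cover elements meeting the set of points compatible
with the blocks chosen so far are called alive.  While their total weight is
below [theta j], each of them is too long to meet two of the continuations by
points of [E j]; the continuations share the weight, so one of them has at most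
its fair part, that is, less than [theta j.+1].  In the limit a point of [Z] is
left uncovered. *)
Lemma moran_bowen_outer N : ((expR (- c))%:E <= bowen_outer T Z t r N)%E.
Proof.
have some_pt j : exists x, x \in E j.
  have := size_gt0 j; case: (E j) => [|x s _]; first by rewrite ltxx.
  by exists x; rewrite mem_head.
have /choice[pt0 Hpt0] := some_pt.
have [z0 Zz0 _] := Z_shadow Hpt0.
rewrite /bowen_outer; case: ifPn => [/eqP ZE|_]; first by move: Zz0; rewrite ZE.
apply: le_ereal_inf_tmp => _ [cov [_ Zcov] <-].
rewrite leNgt; apply/negP => small.
pose w i := expR (- ((cov i).1%:R * t)).
pose alive (C : set Omega) i :=
  `[< bowen_ball T (cov i).1 (cov i).2 r `&` C !=set0 >].
pose g C i : \bar R := if alive C i then (w i)%:E else 0%E.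
pose W C := (\sum_(i <oo) g C i)%E.
pose D j x := [set y | bowen_dist T (len j) (iter (start j) T y) x <= e].
have g0 C i : (0 <= g C i)%E.
  by rewrite /g; case: ifP => // _; rewrite lee_fin expR_ge0.
have alive_long j C i : (W C < (theta j)%:E)%E -> alive C i ->
    (start j.+1 < (cov i).1)%N.
  move=> WC aC; have := le_lt_trans (nneseries_ge_term i (g0 C)) WC.
  rewrite /g aC lte_fin => /lt_le_trans/(_ (theta_le j)).
  rewrite ltr_expR ltrN2 mulrC => H; rewrite ltnNge; apply/negP => le_cov.
  move: H; rewrite ltNge => /negP; apply; rewrite ler_wpM2r ?ler_nat//.
have step j C : (W C < (theta j)%:E)%E ->
    exists2 x, x \in E j & (W (C `&` D j x) < (theta j.+1)%:E)%E.
  move=> WC; apply: contrapT => none.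
  suff : ((theta j)%:E <= W C)%E by rewrite leNgt WC.
  have -> : theta j = \sum_(x <- E j) theta j.+1.
    rewrite big_const_seq count_predT iter_addr_0 -mulr_natr.
    by rewrite /theta big_ord_recr /= invfM mulrA divfK// gt_eqF.
  rewrite -sumEFin.
  apply: (@le_trans _ _ (\sum_(x <- E j) W (C `&` D j x))%E).
    rewrite big_seq [leRHS]big_seq; apply: lee_sum => x xE.
    by rewrite leNgt; apply/negP => H; apply: none; exists x.
  rewrite /W -nneseries_sum//; apply: lee_nneseries => [i _ _|i _].
    exact: sume_ge0.
  rewrite {2}/g; case: ifPn => [aC|/asboolPn naC]; last first.
    rewrite big1// => x _; rewrite /g ifF//; apply/asboolPn => -[y [By [Cy _]]].
    by apply: naC; exists y.
  apply: sum_exclusive_le; first exact: expR_ge0.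
  apply: sub_pairwise (E_sep j) => x x' xx'; apply/negP => /andP[].
  move=> /asboolP[y [/= By [_ Dy]]] /asboolP[y' [/= By' [_ Dy']]].
  move: By By' Dy Dy'; rewrite /bowen_ball /D /= => By By' Dy Dy'.
  have long := alive_long _ _ _ WC aC.
  have yy' : bowen_dist T (len j)
      (iter (start j) T y) (iter (start j) T y') < 2 * r.
    apply: (@le_lt_trans _ _ (bowen_dist T (cov i).1 y y')).
      apply: bowen_dist_shift; apply: leq_trans (ltnW long).
      by rewrite startS leq_add2l leq_addr.
    apply: le_lt_trans (bowen_dist_triangle _ _ (cov i).2 _ _) _.
    by rewrite bowen_dist_sym; lra.
  have := bowen_dist_triangle T (len j) (iter (start j) T y) x x'.
  have := bowen_dist_triangle T (len j) (iter (start j) T y')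
    (iter (start j) T y) x'.
  rewrite (bowen_dist_sym T _ x (iter _ _ _)) => h1 h2; move: xx' => /=; lra.
(* A continuation depends only on the stage and on the set of points that remain
compatible, which makes the choice of the blocks a plain recursion. *)
have /choice[pick Hpick] : forall p : nat * set Omega, exists x, x \in E p.1 /\
    ((W p.2 < (theta p.1)%:E)%E -> (W (p.2 `&` D p.1 x) < (theta p.1.+1)%:E)%E).
  move=> [j C] /=; have [/step[x xE Wx]|nW] := pselect (W C < (theta j)%:E)%E.
    by exists x.
  by have [x xE] := some_pt j; exists x.
pose C := fix C j := if j is k.+1 then C k `&` D k (pick (k, C k)) else setT.
have WC j : (W (C j) < (theta j)%:E)%E.
  elim: j => [|j IH] /=; last exact: (Hpick (j, C j)).2.
  rewrite /theta big_ord0 invr1 mulr1; apply: le_lt_trans small.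
  apply: lee_nneseries => // i _.
  by rewrite /g; case: ifP => // _; rewrite lee_fin expR_ge0.
have [y Zy Hy] := Z_shadow (fun j => (Hpick (j, C j)).1).
have Cy j : C j y by elim: j => //= j Cj; split=> //; exact: Hy.
have [i _ By] := Zcov y Zy.
have aliveC j : alive (C j) i by apply/asboolP; exists y.
have := alive_long (cov i).1 _ _ (WC _) (aliveC _).
have le_start j : (j <= start j)%N.
  elim: j => // j IH; rewrite startS; lia.
have := le_start (cov i).1.+1; lia.
Qed.

End Moran.

(** * Level sets *)

(** The infimum of the admissible thresholds at [n] tends to zero; the shift by
[n.+1%:R^-1] makes it admissible itself. *)
Lemma diagonal_threshold (R : realType) (P : R -> nat -> Prop) :
  (forall eta eta' n, eta <= eta' -> P eta n -> P eta' n) ->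
  (forall eta, 0 < eta -> exists N, forall n, (N <= n)%N -> P eta n) ->
  exists eta : nat -> R, (exists N, forall n, (N <= n)%N -> P (eta n) n) /\
    forall k, 0 < k -> exists N, forall n, (N <= n)%N -> eta n <= k.
Proof.
move=> Pmono Pev.
pose S n := [set eta | 0 < eta /\ P eta n].
have Slb n : has_lbound (S n) by exists 0 => x [/ltW].
exists (fun n => inf (S n) + n.+1%:R^-1); split.
  have [N HN] := Pev 1 ltr01; exists N => n Nn.
  have Sn : has_inf (S n).
    by split => //; exists 1; split=> //; exact: HN.
  have n0 : (0 : R) < n.+1%:R^-1 by rewrite invr_gt0 ltr0n.
  have [x [_ Px] xlt] := inf_adherent n0 Sn.
  by apply: Pmono Px; exact: ltW.
move=> k k0; have k20 : 0 < k / 2 by rewrite divr_gt0.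
have [N1 HN1] := Pev _ k20; have [N2 HN2] := natmul_ge 1 k20.
exists (N1 + N2)%N => n Nn; rewrite [leRHS]splitr; apply: lerD.
  by apply: ge_inf => //; split=> //; apply: HN1; lia.
by rewrite -[leLHS]mul1r ler_pdivrMr ?ltr0n//; apply: HN2; lia.
Qed.

Section Spectrum.
Context {R : realType} {Omega : pmetricType R} (T : Omega -> Omega).
Variables (nu : probability (borelType Omega) R) (X : nat -> Omega -> R).
Variables (I : R -> \bar R) (h : R).
Hypothesis T_continuous : continuous T.
Hypothesis nu_AB : ahlfors_bowen T nu h.
Hypothesis X_measurable : forall n, (0 < n)%N ->
  measurable_fun [set: borelType Omega] (X n).
Hypothesis X_bowen : weak_bowen T X.
Hypothesis X_LDP : LDP nu X I.

Lemma level_setP a x (k : R) : level_set X a x -> 0 < k ->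
  exists N, forall n, (N <= n)%N -> `|X n x / n%:R - a| < k.
Proof.
move=> /cvgrPdist_lt H /H[N _ HN].
by exists N => n /HN /=; rewrite distrC.
Qed.

(** By the weak Bowen condition a Bowen ball around a point with average near
[a] consists of points with average near [a]. *)
Lemma bowen_ball_deviation a (eta : R) : 0 < eta ->
  exists2 delta : R, 0 < delta & exists N, forall n, (N <= n)%N -> forall x,
    `|X n x / n%:R - a| < eta / 2 ->
    bowen_ball T n x delta `<=` [set y | `|X n y / n%:R - a| <= eta].
Proof.
move=> eta0; have [delta d0 HX] := weak_bowen_le X_bowen.
have [|N HN] := HX (eta / 2); first by rewrite divr_gt0.
exists delta => //; exists N.+1 => n Nn x xa y /= xy.
have n0 : (0 < n)%N by exact: leq_ltn_trans Nn.
have := HN n (ltnW Nn) x y (ltW xy).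
rewrite -ler_pdivrMr ?ltr0n// -{1}(normr_nat R n) -normf_div mulrBl.
by move: xa; rewrite ltr_norml !ler_norml; lra.
Qed.

(** Points whose averages converge to [a] carry around them Bowen balls of mass
about [exp (- n h)] on which the averages are near [a]; so deviations towards
[a] cannot be rarer than that. *)
Lemma level_set_rate_le a x : level_set X a x -> (I a <= h%:E)%E.
Proof.
move=> Kx; rewrite leNgt; apply/negP => hIa.
have [b hb bIa] : exists2 b : R, h < b & (b%:E < I a)%E.
  case: (I a) hIa => [s| |]//.
  - by rewrite lte_fin => hs; exists ((h + s) / 2); rewrite ?lte_fin midf_lt.
  - by move=> _; exists (h + 1); rewrite ?ltry// ltrDl.
have [eta eta0 [N1 HN1]] := LDP_upper X_measurable X_LDP bIa.
have [delta d0 [N2 HN2]] := bowen_ball_deviation a eta0.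
have [|N3 HN3] := level_setP Kx (_ : 0 < eta / 2); first by rewrite divr_gt0.
have [C C0 HC] := nu_AB.2 _ d0.
have C20 : 0 < C^-1 / 2 by rewrite divr_gt0 ?invr_gt0.
have bh0 : 0 < b - h by rewrite subr_gt0.
have [N4 HN4] := expR_decay bh0 C20.
pose n := (N1 + N2 + N3 + N4).+1.
have n0 : (0 < n)%N by [].
have [lo _] := HC n x n0.
have : ((C^-1 * expR (- (n%:R * h)))%:E <= (expR (- (n%:R * b)))%:E)%E.
  apply: le_trans lo _; apply: le_trans (HN1 n _); last by rewrite /n; lia.
  apply: le_measure; rewrite ?inE.
  - exact: measurable_bowen_ball.
  - exact: measurable_deviation_le.
  - by apply: HN2; [rewrite /n; lia|apply: HN3; rewrite /n; lia].
have -> : - (n%:R * b) = - (n%:R * (b - h)) + - (n%:R * h) by ring.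
rewrite lee_fin expRD ler_pM2r ?expR_gt0// => H.
have : expR (- (n%:R * (b - h))) <= C^-1 / 2 by apply: HN4; rewrite /n; lia.
have : 0 < C^-1 by rewrite invr_gt0.
lra.
Qed.

(** The Bowen balls around separated points with averages near [a] are disjoint
and contained in a slightly larger deviation event, so that the large deviations
estimate bounds their number; a maximal separated set provides the covers. *)
Lemma htop_level_set_le a s : I a = s%:E -> s <= h ->
  (htop T (level_set X a) <= (h - s)%:E)%E.
Proof.
move=> Ias sh; apply: htop_le => e e0.
apply/lee_addgt0Pr => k k0; rewrite -EFinD.
apply: entropy_at_le => N.
apply: bowen_outer_eq0 => [|zeta zeta0]; first by lra.
have [|eta eta0 [N1 HN1]] :=
  @LDP_upper _ _ nu X I X_measurable X_LDP a (s - k / 2).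
  by rewrite Ias lte_fin; lra.
have [delta d0 [N2 HN2]] := bowen_ball_deviation a eta0.
pose d := Num.min e delta.
have dd0 : 0 < d by rewrite lt_min e0.
have d20 : 0 < d / 2 by rewrite divr_gt0.
have [C C0 HC] := nu_AB.2 _ d20.
have k20 : 0 < k / 2 by rewrite divr_gt0.
have /choice[Nk HNk] : forall j, exists Nj, forall n, (Nj <= n)%N ->
    expR (- (n%:R * (k / 2))) <= C^-1 * (zeta / (2 ^ j.+1)%:R).
  by move=> j; apply: expR_decay; rewrite ?mulr_gt0 ?invr_gt0 ?ltr0n ?expn_gt0.
(* [j <= n j]: a point whose average is near [a] at all large times is caught
at the time [n j] for [j] large. *)
pose n j := (j + N + N1 + N2 + Nk j).+1.
pose G j := [set x | `|X (n j) x / (n j)%:R - a| < eta / 2].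
have /choice[F HF] := fun j =>
  ahlfors_bowen_separated T_continuous (G j) nu_AB (ltn0Sn _ : (0 < n j)%N) dd0.
exists (fun j => [seq (n j, x) | x <- F j]); split.
- by move=> j p /mapP[x _ ->] /=; rewrite /n; lia.
- move=> z Kz; have [|N3 HN3] := level_setP Kz (_ : 0 < eta / 2).
    by rewrite divr_gt0.
  have [_ _ /(_ z)[|x xF xz]] := HF N3; first by apply: HN3; rewrite /n; lia.
  exists N3; exists (n N3, x) => /=; first by apply/mapP; exists x.
  by apply: lt_le_trans xz _; rewrite ge_min lexx.
- move=> j; rewrite big_map /= big_const_seq count_predT iter_addr_0.
  rewrite -(mulr_natl (expR _)).
  have [sepF FG _] := HF j.
  have : ((size (F j))%:R * (C^-1 * expR (- ((n j)%:R * h))) <=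
      expR (- ((n j)%:R * (s - k / 2)))).
    rewrite -lee_fin; apply: le_trans (HN1 (n j) _); last by rewrite /n; lia.
    apply: separated_measure_le sepF _ _ => //.
    + exact: measurable_deviation_le.
    + move=> x xF; apply: subset_trans (HN2 (n j) _ x (FG x xF)); last first.
        by rewrite /n; lia.
      move=> y; rewrite /bowen_ball /= => /lt_le_trans; apply.
      apply: (@le_trans _ _ d); last by rewrite ge_min lexx orbT.
      by rewrite ler_pdivrMr// ler_pMr// ler1n.
    + by move=> x; have [] := HC (n j) x (ltn0Sn _).
  have := HNk j (n j); move=> /[swap].
  have -> : - ((n j)%:R * (s - k / 2)) =
      - ((n j)%:R * h) + ((n j)%:R * (h - s + k / 2)) by ring.
  rewrite expRD mulrA [leLHS]mulrC ler_pM2l ?expR_gt0// ler_pdivrMr// => H1 H2.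
  have -> : - ((n j)%:R * (h - s + k)) =
      - ((n j)%:R * (h - s + k / 2)) + - ((n j)%:R * (k / 2)) by field.
  rewrite expRD mulrA expRN.
  apply: (@le_trans _ _ (C * expR (- ((n j)%:R * (k / 2))))).
    by rewrite ler_wpM2r ?expR_ge0// ler_pdivrMr ?expR_gt0// mulrC.
  by rewrite -ler_pdivlMl// H2// /n; lia.
Qed.

(** The Bowen balls around a spanning set exhaust the measure of the points with
averages near [a], and each has measure at most [exp (- n h)] up to a constant,
so they are numerous. *)
Lemma separated_level_blocks a (b t1 rho : R) :
  (I a < b%:E)%E -> t1 < h - b -> 0 < rho ->
  exists (E : nat -> seq Omega) (n1 : nat),
    [/\ forall n, (n1 <= n)%N ->
          pairwise (fun x y => rho <= bowen_dist T n x y) (E n),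
        forall n, (n1 <= n)%N -> expR (t1 * n%:R) <= (size (E n))%:R &
        forall k, 0 < k -> exists N, forall n, (N <= n)%N ->
          forall x, x \in E n -> `|X n x - a * n%:R| <= k * n%:R].
Proof.
move=> Iab t1b rho0.
pose G (eta : R) n := [set x | `|X n x / n%:R - a| < eta].
pose P (eta : R) n := (0 < n)%N -> ((expR (- (n%:R * b)))%:E <= nu (G eta n))%E.
have [eta [[N1 HN1] eta_small]] : exists eta : nat -> R,
    (exists N, forall n, (N <= n)%N -> P (eta n) n) /\
    forall k, 0 < k -> exists N, forall n, (N <= n)%N -> eta n <= k.
  apply: diagonal_threshold => [d d' n dd' Pd n0|d d0].
    apply: le_trans (Pd n0) _; apply: le_measure; rewrite ?inE.
    - exact: measurable_deviation_lt.
    - exact: measurable_deviation_lt.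
    - by move=> x /= /lt_le_trans; exact.
  have [N HN] := LDP_lower X_measurable X_LDP Iab d0.
  by exists N => n Nn _; exact: HN.
have /choice[E HE] : forall n, exists E : seq Omega, (0 < n)%N ->
    [/\ pairwise (fun x y => rho <= bowen_dist T n x y) E,
        forall x, x \in E -> G (eta n) n x &
        forall y, G (eta n) n y ->
          exists2 x, x \in E & bowen_dist T n x y < rho].
  move=> n; have [n0|n0] := pselect (0 < n)%N; last by exists [::].
  have [E HE] :=
    ahlfors_bowen_separated T_continuous (G (eta n) n) nu_AB n0 rho0.
  by exists E.
have [C C0 HC] := nu_AB.2 _ rho0.
have gap0 : 0 < h - b - t1 by rewrite subr_gt0.
have [|N2 HN2] := @expR_decay _ _ C^-1 gap0; first by rewrite invr_gt0.
exists E, (N1 + N2).+1; split=> [n Nn|n Nn|k k0].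
- by have [] := HE n (leq_ltn_trans (leq0n _) Nn).
- have n0 : (0 < n)%N by exact: leq_ltn_trans Nn.
  have [_ _ spanE] := HE n n0.
  have mG := measurable_deviation_lt X_measurable a (eta n) n0.
  have : expR (- (n%:R * b)) <= (size (E n))%:R * (C * expR (- (n%:R * h))).
    rewrite -lee_fin; apply: le_trans (HN1 n _ n0) _; first by lia.
    apply: (spanning_measure_le T_continuous mG spanE) => x.
    by have [] := HC n x n0.
  have := HN2 n; have -> : (N2 <= n)%N by lia.
  move=> /(_ isT) decay.
  rewrite mulrA -ler_pdivrMr ?expR_gt0// -expRN opprK -expRD.
  rewrite -ler_pdivrMr// => H; apply: le_trans H.
  have -> : t1 * n%:R =
      - (n%:R * b) + n%:R * h + - (n%:R * (h - b - t1)) by ring.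
  by rewrite [leLHS]expRD ler_wpM2l ?expR_ge0.
- have [N HN] := eta_small k k0.
  exists N.+1 => n Nn x xE; have n0 : (0 < n)%N by exact: leq_ltn_trans Nn.
  have [_ /(_ x xE) + _] := HE n n0; rewrite /G /= => /ltW xa.
  have := le_trans xa (HN n (ltnW Nn)).
  rewrite -(@ler_pM2r _ n%:R) ?ltr0n// -{2}(normr_nat R n) -normrM.
  by rewrite mulrBl divfK// pnatr_eq0 -lt0n.
Qed.

Section Lower.
Hypothesis Omega_compact : compact [set: Omega].
Hypothesis X_additive : weakly_almost_additive T X.
Hypothesis T_exact : strongly_topologically_exact T.

(** The scale [e] comes from the weak Bowen condition, the gap [M] from
exactness at that scale; block lengths [n0], [n0 + 1], and so on are negligible
with respect to the sum of the preceding ones, yet make the errors per unit of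
length tend to zero. *)
Lemma level_set_shadowing a (b t1 : R) : (I a < b%:E)%E -> t1 < h - b ->
  exists (e : R) (M n1 : nat) (E : nat -> seq Omega), [/\ 0 < e, (0 < n1)%N,
    forall n, (n1 <= n)%N ->
      pairwise (fun x y => 2 * e + 2 * e <= bowen_dist T n x y) (E n),
    forall n, (n1 <= n)%N -> expR (t1 * n%:R) <= (size (E n))%:R &
    forall n0, (n1 <= n0)%N -> forall pts : nat -> Omega,
      (forall j, pts j \in E (n0 + j)%N) ->
      exists2 y, level_set X a y & forall j, bowen_dist T (n0 + j)
        (iter (start M (fun j => n0 + j)%N j) T y) (pts j) <= e].
Proof.
move=> Iab t1b.
have [e e0 HX] := weak_bowen_le X_bowen.
have [M M0 exM] := T_exact e0.
have [A [_ A_small A_add]] := X_additive.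
have [K K0 HK] : exists2 K, 0 <= K &
    forall m x, (0 < m)%N -> `|X m x| <= K * m%:R.
  apply: (additive_linear_bound A_add (delta := e)) => [n n0|].
    have [E [_ _ spanE]] :=
      ahlfors_bowen_separated T_continuous setT nu_AB n0 e0.
    by exists E => y; exact: spanE.
  have [N HN] := HX 1 ltr01; exists N => n Nn x y xy.
  by rewrite -[leRHS]mul1r; exact: HN.
have sep0 : 0 < 2 * e + 2 * e by lra.
have [E [n1 [sepE sizeE devE]]] := separated_level_blocks Iab t1b sep0.
exists e, M, n1.+1, E; split=> // [n /ltnW|n /ltnW|n0 n10 pts ptsE].
- exact: sepE.
- exact: sizeE.
have len0 j : (0 < n0 + j)%N by lia.
have [y Hy] := shadowing exM pts Omega_compact T_continuous len0.
exists y => //.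
apply: (level_set_blocks A_small A_add M0 len0 K0 _ HK) => // k k0.
have k20 : 0 < k / 2 by rewrite divr_gt0.
have [N1 HN1] := HX _ k20; have [N2 HN2] := devE _ k20.
exists (N1 + N2)%N => i Ni.
have := HN1 (n0 + i)%N _ _ _ (Hy i); have := HN2 (n0 + i)%N _ _ (ptsE i).
have -> : (N1 <= n0 + i)%N by lia.
have -> : (N2 <= n0 + i)%N by lia.
move=> /(_ isT) + /(_ isT); rewrite !ler_norml; lra.
Qed.

Lemma level_set_nonempty a : (I a < +oo)%E -> level_set X a !=set0.
Proof.
move=> Ia; have [b Iab] : exists b : R, (I a < b%:E)%E.
  case: (I a) Ia => [s| |]// _; last by exists 0; rewrite ltNyr.
  by exists (s + 1); rewrite lte_fin ltrDl.
have [|e [M [n1 [E [_ _ _ sizeE shadow]]]]] :=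
  @level_set_shadowing a b (h - b - 1) Iab.
  by rewrite ltrBlDr ltrDl.
have /choice[pts ptsE] : forall j, exists x, x \in E (n1 + j)%N.
  move=> j; have := sizeE (n1 + j)%N (leq_addr _ _).
  case: (E _) => [|x s _]; last by exists x; rewrite mem_head.
  by rewrite leNgt expR_gt0.
by have [y Ky _] := shadow n1 (leqnn _) pts ptsE; exists y.
Qed.

(** An exponent [t < t1 < h - I a] leaves a margin that pays, once [n0] is
large, for the gaps [M] between blocks and for the block in progress. *)
Lemma htop_level_set_ge a s : I a = s%:E -> s <= h ->
  ((h - s)%:E <= htop T (level_set X a))%E.
Proof.
move=> Ias sh; apply/lee_subgt0Pr => k k0; rewrite -EFinB.
pose t1 := h - s - k.
have [||e [M [n1 [E [e0 n10 sepE sizeE shadow]]]]] :=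
    @level_set_shadowing a (s + k / 2) t1.
- by rewrite Ias lte_fin; lra.
- by rewrite /t1; lra.
apply: (htop_ge e0); apply: entropy_at_ge => t tt1.
have [t0|t0] := leP t 0.
  exists 1 => // N; apply: bowen_outer_nonpos => //.
  by apply: level_set_nonempty; rewrite Ias ltry.
have gap0 : 0 < t1 - t by rewrite subr_gt0.
have [N0 HN0] := natmul_ge (t * (1 + M%:R)) gap0.
pose n0 := (N0 + n1)%N.
exists (expR (- (t * (n0 + M)%:R))); first exact: expR_gt0.
move=> N.
apply: (@moran_bowen_outer _ _ T M n0 e e t t1 (fun j => E (n0 + j)%N)).
- by rewrite /n0; lia.
- exact: ltW.
- by apply: HN0; rewrite /n0; lia.
- by move=> j; apply: sepE; rewrite /n0; lia.
- by move=> j; apply: sizeE; rewrite /n0; lia.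
- by move=> pts ptsE; apply: shadow => //; rewrite /n0; lia.
Qed.

End Lower.

End Spectrum.

Theorem theoremC (R : realType) (Omega : pmetricType R)
    (T : Omega -> Omega) (nu : probability (borelType Omega) R)
    (X : nat -> Omega -> R) (I : R -> \bar R)
    (Omega_compact : compact [set: Omega])
    (T_continuous : continuous T)
    (htop_fin : (htop T [set: Omega] < +oo)%E)
    (nu_AB : ahlfors_bowen T nu (fine (htop T [set: Omega])))
    (X_measurable : forall n, (0 < n)%N ->
      measurable_fun [set: borelType Omega] (X n))
    (A1 : weak_bowen T X)
    (A2 : weakly_almost_additive T X)
    (A3 : expansive T /\ strongly_topologically_exact T)
    (X_LDP : LDP nu X I)
    (I_good : good_rate_function I)
    (I_convex : essentially_strictly_convex I) :
  exists al ar : \bar R,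
    [/\ (al <= ar)%E,
        [set a : R | (al < a%:E < ar)%E] `<=` level_spectrum X,
        level_spectrum X `<=` [set a : R | (al <= a%:E <= ar)%E] &
        forall a : R, (al < a%:E < ar)%E ->
          htop T (level_set X a) = (htop T [set: Omega] - I a)%E].
Proof.
have [_ T_exact] := A3; have [[I_NNy [a0 Ia0] I_cvx] _] := I_convex.
have [_ I_ge0] := X_LDP.1.
set h := fine (htop T setT) in nu_AB.
have htopE : htop T setT = h%:E.
  rewrite /h; move: htop_fin nu_AB.1; rewrite /h; case: (htop T setT) => //=.
  by rewrite ltxx.
pose dom := EFin @` edom I.
have dom_fin a : edom I a -> exists2 s : R, I a = s%:E & s <= h.
  move=> Ia; have [x Kx] := level_set_nonempty T_continuous nu_AB X_measurable
    A1 X_LDP Omega_compact A2 T_exact Ia.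
  have := level_set_rate_le T_continuous nu_AB X_measurable A1 X_LDP Kx.
  by case: (I a) (I_ge0 a) => [s| |]// _; rewrite lee_fin => sh; exists s.
have interval a : (ereal_inf dom < a%:E < ereal_sup dom)%E -> edom I a.
  move=> /andP[/ereal_inf_lt[_ [x Ix <-]] + /ereal_sup_gt[_ [y Iy <-]]].
  rewrite !lte_fin => xa ay.
  have xy : 0 < y - x by lra.
  pose l := (y - a) / (y - x).
  have l01 : 0 < l < 1.
    rewrite /l ltr_pdivrMr// mul1r ltrD2l ltrN2 xa andbT.
    by rewrite divr_gt0// subr_gt0.
  have aE : a = l * x + (1 - l) * y by rewrite /l; field; rewrite gt_eqF.
  rewrite aE; apply: le_lt_trans (I_cvx x y l l01) _.
  have [sx -> _] := dom_fin x Ix; have [sy -> _] := dom_fin y Iy.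
  by rewrite -!EFinM -EFinD ltry.
exists (ereal_inf dom), (ereal_sup dom); split.
- have dom0 : dom a0%:E by exists a0 => //; rewrite /edom /= ltey.
  by apply: le_trans (ereal_sup_ubound dom0); exact: ereal_inf_lbound.
- move=> a /interval.
  exact: (level_set_nonempty T_continuous nu_AB X_measurable A1 X_LDP
    Omega_compact A2 T_exact).
- move=> a [x Kx] /=.
  have Ia : dom a%:E.
    exists a => //; rewrite /edom /=; apply: le_lt_trans (ltry h).
    exact: (level_set_rate_le T_continuous nu_AB X_measurable A1 X_LDP Kx).
  by rewrite ereal_inf_lbound// ereal_sup_ubound.
- move=> a /interval/dom_fin[s Ias sh].
  rewrite htopE Ias -EFinB; apply/eqP; rewrite eq_le; apply/andP; split.
    exact: (htop_level_set_le T_continuous nu_AB X_measurable A1 X_LDP Ias sh).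
  exact: (htop_level_set_ge T_continuous nu_AB X_measurable A1 X_LDP
    Omega_compact A2 T_exact Ias sh).
Qed.
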